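(* Let $G$ be a finite group. Assume that for every almost simple group $X$ which occurs as a homomorphic image of $G$ the prime graph question has a positive answer, i.e. $\Pi(V(\mathbb{Z}X)) = \Pi(X)$. Then the prime graph question has a positive answer for $G$, i.e. $\Pi(V(\mathbb{Z}G)) = \Pi(G)$.
   Context: For a group $H$ (not necessarily finite), the prime graph $\Pi(H)$ is the graph whose vertices are the primes $p$ for which $H$ has an element of order $p$; two different vertices $p$ and $q$ are joined by an edge if and only if $H$ has an element of order $p\cdot q$. For a finite group $G$, $\mathbb{Z}G$ is the integral group ring and $V(\mathbb{Z}G)$ is the group of normalised units, i.e. the subgroup of the unit group of $\mathbb{Z}G$ consisting of all units of augmentation $1$ (it contains $G$). The prime graph question (PQ) has a positive answer for $G$ if $\Pi(V(\mathbb{Z}G)) = \Pi(G)$. An almost simple group of type $S$, where $S$ is a finite non-abelian simple group, is a subgroup of $\mathrm{Aut}(S)$ containing $\mathrm{Inn}(S)\cong S$; a group is almost simple if it is almost simple of type $S$ for some such $S$ (up to isomorphism). *)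

(* Defs.v *)
From HB Require Import structures.
From mathcomp Require Import all_boot all_order all_algebra all_fingroup all_solvable.
Set Implicit Arguments. Unset Strict Implicit. Unset Printing Implicit Defensive.
Import GRing.Theory.
Local Open Scope ring_scope.

(* An alias is needed: {ffun gT -> R} carries the pointwise product. *)
Definition grpring (R : nzRingType) (gT : finGroupType) := {ffun gT -> R}.

Section GroupRing.
Variables (R : nzRingType) (gT : finGroupType).
Local Notation RG := (grpring R gT).

HB.instance Definition _ := GRing.Zmodule.on RG.

Definition gr_one : RG := [ffun g => (g == 1%g)%:R].
Definition gr_mul (u v : RG) : RG :=
  [ffun g => \sum_h u h * v (h^-1 * g)%g].

Lemma gr_mulA : associative gr_mul.
Proof.
move=> u v w; apply/ffunP=> g; rewrite !ffunE.
under eq_bigr => h _.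
  rewrite ffunE big_distrr /= (reindex_inj (mulgI h^-1%g)) /=.
  under eq_bigr => k _ do rewrite mulrA invMg invgK -mulgA mulKVg.
  over.
rewrite exchange_big /=; apply: eq_bigr => k _.
by rewrite ffunE big_distrl.
Qed.

Lemma gr_mul1 : left_id gr_one gr_mul.
Proof.
move=> u; apply/ffunP=> g; rewrite ffunE (bigD1 1%g) //= big1 => [|h /negPf h1].
  by rewrite addr0 ffunE eqxx mul1r invg1 mul1g.
by rewrite ffunE h1 mul0r.
Qed.

Lemma gr_mulr1 : right_id gr_one gr_mul.
Proof.
move=> u; apply/ffunP=> g; rewrite ffunE (bigD1 g) //= big1 => [|h hg].
  by rewrite addr0 ffunE mulVg eqxx mulr1.
by rewrite ffunE -eq_mulVg1 (negPf hg) mulr0.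
Qed.

Lemma gr_mulDl : left_distributive gr_mul +%R.
Proof.
move=> u v w; apply/ffunP=> g; rewrite !ffunE -big_split /=.
by apply: eq_bigr => h _; rewrite ffunE mulrDl.
Qed.

Lemma gr_mulDr : right_distributive gr_mul +%R.
Proof.
move=> u v w; apply/ffunP=> g; rewrite !ffunE -big_split /=.
by apply: eq_bigr => h _; rewrite ffunE mulrDr.
Qed.

Lemma gr_one_neq0 : gr_one != 0.
Proof.
by apply/eqP => /ffunP/(_ 1%g)/eqP; rewrite !ffunE eqxx oner_eq0.
Qed.

HB.instance Definition _ := GRing.Zmodule_isNzRing.Build RG
  gr_mulA gr_mul1 gr_mulr1 gr_mulDl gr_mulDr gr_one_neq0.

Definition augm (u : RG) : R := \sum_g u g.

Lemma augm1 : augm 1 = 1.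
Proof.
rewrite /augm (bigD1 1%g) //= big1 => [|g /negPf g1]; last by rewrite ffunE g1.
by rewrite addr0 ffunE eqxx.
Qed.

Lemma augmM (u v : RG) : augm (u * v) = augm u * augm v.
Proof.
rewrite /augm; under eq_bigr do rewrite ffunE.
rewrite exchange_big big_distrl /=; apply: eq_bigr => h _.
by rewrite -big_distrr [in RHS](reindex_inj (mulgI h^-1%g)).
Qed.

End GroupRing.

Section NormalisedUnits.
Variable gT : finGroupType.
Local Notation ZG := (grpring int gT).

(* A normalised unit is stored together with its (unique) inverse, so that
   membership is decidable and equality of units is equality of the first
   components (nunit_inj). *)
Record nunit := NUnit {
  nunit_pair :> ZG * ZG;
  _ : [&& nunit_pair.1 * nunit_pair.2 == 1, nunit_pair.2 * nunit_pair.1 == 1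
        & augm nunit_pair.1 == 1] }.

HB.instance Definition _ := [isSub for nunit_pair].
HB.instance Definition _ := [Choice of nunit by <:].

Lemma nunitP (u : nunit) :
  [/\ u.1 * u.2 = 1, u.2 * u.1 = 1, augm u.1 = 1 & augm u.2 = 1].
Proof.
case: u => -[u v] /= /and3P[/eqP uv /eqP vu /eqP au]; split=> //.
by rewrite -[LHS]mul1r -au -augmM uv augm1.
Qed.

Lemma nunit_inj (u v : nunit) : u.1 = v.1 -> u = v.
Proof.
have [_ u2 _ _] := nunitP u; have [v1 _ _ _] := nunitP v.
move=> uv; apply: val_inj; rewrite /= [LHS]surjective_pairing.
rewrite [RHS]surjective_pairing uv; congr pair.
by rewrite -[LHS]mulr1 -v1 mulrA -uv u2 mul1r.
Qed.

Fact nunit_one_subproof :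
  [&& (1 : ZG) * 1 == 1, (1 : ZG) * 1 == 1 & augm (1 : ZG) == 1].
Proof. by rewrite mulr1 augm1 !eqxx. Qed.
Definition nunit_one : nunit := @NUnit (1, 1) nunit_one_subproof.

Fact nunit_mul_subproof (u v : nunit) :
  [&& (u.1 * v.1) * (v.2 * u.2) == 1, (v.2 * u.2) * (u.1 * v.1) == 1
    & augm (u.1 * v.1) == 1].
Proof.
have [u1 u2 u3 _] := nunitP u; have [v1 v2 v3 _] := nunitP v.
rewrite !mulrA -(mulrA u.1) v1 mulr1 u1 -(mulrA v.2) u2 mulr1 v2.
by rewrite augmM u3 v3 mulr1 !eqxx.
Qed.
Definition nunit_mul (u v : nunit) : nunit :=
  @NUnit (u.1 * v.1, v.2 * u.2) (nunit_mul_subproof u v).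

Fact nunit_inv_subproof (u : nunit) :
  [&& u.2 * u.1 == 1, u.1 * u.2 == 1 & augm u.2 == 1].
Proof. by have [-> -> _ ->] := nunitP u; rewrite !eqxx. Qed.
Definition nunit_inv (u : nunit) : nunit :=
  @NUnit (u.2, u.1) (nunit_inv_subproof u).

Fact nunit_mulA : associative nunit_mul.
Proof. by move=> u v w; apply: nunit_inj; rewrite /= mulrA. Qed.
Fact nunit_mul1 : left_id nunit_one nunit_mul.
Proof. by move=> u; apply: nunit_inj; rewrite /= mul1r. Qed.
Fact nunit_mulr1 : right_id nunit_one nunit_mul.
Proof. by move=> u; apply: nunit_inj; rewrite /= mulr1. Qed.
Fact nunit_mulV : left_inverse nunit_one nunit_inv nunit_mul.
Proof. by move=> u; apply: nunit_inj => /=; have [] := nunitP u. Qed.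
Fact nunit_mulrV : right_inverse nunit_one nunit_inv nunit_mul.
Proof. by move=> u; apply: nunit_inj => /=; have [] := nunitP u. Qed.

HB.instance Definition _ := isGroup.Build nunit
  nunit_mulA nunit_mul1 nunit_mulr1 nunit_mulV nunit_mulrV.

End NormalisedUnits.

Local Open Scope group_scope.

(* The library's #[x] is only available in finite groups. *)
Definition has_order (H : groupType) (x : H) (n : nat) : Prop :=
  [/\ (0 < n)%N, x ^+ n = 1 & forall m, (0 < m < n)%N -> x ^+ m <> 1].

Lemma has_orderE (gT : finGroupType) (x : gT) n : has_order x n <-> #[x] = n.
Proof.
split=> [[n0 xn xm]|<-].
  apply/eqP; rewrite eqn_leq dvdn_leq ?order_dvdn ?xn //= leqNgt.
  by apply/negP => lt; apply: (xm #[x]); rewrite ?order_gt0 ?expg_order.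
split; rewrite ?order_gt0 ?expg_order // => m /andP[m0 mx] /eqP.
by rewrite -order_dvdn => /(dvdn_leq m0); rewrite leqNgt mx.
Qed.

Record graph := Graph { vertex : nat -> Prop; edge : nat -> nat -> Prop }.

Definition same_graph (A B : graph) : Prop :=
  (forall p, vertex A p <-> vertex B p) /\
  (forall p q, edge A p q <-> edge B p q).

Definition prime_vertex (H : groupType) (p : nat) : Prop :=
  prime p /\ exists x : H, has_order x p.

Definition prime_graph (H : groupType) : graph :=
  Graph (prime_vertex H) (fun p q =>
    [/\ prime_vertex H p, prime_vertex H q, p <> q
      & exists x : H, has_order x (p * q)%N]).

Definition PQ (gT : finGroupType) : Prop :=
  same_graph (prime_graph (nunit gT)) (prime_graph gT).

Definition almost_simple (X : finGroupType) : Prop :=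
  exists (S : finGroupType) (A : {group {perm S}}),
    [/\ simple [set: S], ~~ abelian [set: S],
        (* Inn(S), the image of conjugation, lies in A *)
        conj_aut [set: S] @* [set: S] \subset A,
        A \subset Aut [set: S]
      & [set: X] \isog A].

(* Main.v *)
Require Import Defs.
From mathcomp Require Import all_boot all_order all_algebra all_fingroup all_solvable.
From mathcomp Require Import all_field all_character.
Set Implicit Arguments. Unset Strict Implicit. Unset Printing Implicit Defensive.
Import Order.TTheory GRing.Theory Num.Theory.
Local Open Scope group_scope.

(** The proof studies a torsion unit u only through the integers
    paug A u, the sum of the coefficients of u over a set A of group elements
    that is stable under conjugation (a sum of partial augmentations).

    Three facts about a unit u of augmentation 1 with u ^+ n = 1 carry the
    argument.  (i) berman_higman: if u is not 1, its coefficient at 1 is 0.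
    (ii) paug_eq0: paug A u = 0 as soon as no element of A has an order whose
    prime divisors all divide n.  (iii) paug_exp_prime: modulo a prime p, the
    sum of u ^+ (p ^ k) over A is the sum of u over the (p ^ k)-th roots of A.
    Facts (ii) and (iii) come from the same count: expand a power of u of
    exponent r ^ k as a sum over words of length r ^ k and group the words
    into orbits under rotation.  Rotating a word conjugates its product, so
    orbits contribute multiples of their length; short orbits consist of
    periodic words, whose products are powers with a large exponent.

    Let u have order pq, with p and q distinct primes, over a group G that has
    no element of order pq, and let G be of minimal order with this property
    among the groups that satisfy the hypothesis of the theorem.  For a
    nontrivial normal subgroup N, the image of u over G / N does not have order
    pq, since by minimality G / N, hence G, would have an element of order
    divisible by pq; say that the p-th power of this image is 1.  Then q
    divides #|N|, because u ^+ p has order q and is trivial over G / N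
    (prime_dvd_kernel).  Moreover p divides #|N|:
    otherwise the image of u is a unit of order p, hence by (i) and (ii) its
    coefficients over the nontrivial p-elements of G / N add up to 1; as G has
    no element of order pq and N is a p'-group, this sum is also the sum of
    the coefficients of u over the p-elements of G, which (iii) and (i)
    show to be 0 modulo p (prime_dvd_normal).

    So both p and q divide the order of every nontrivial normal subgroup.
    Two commuting subgroups of orders divisible by p and q would produce an
    element of order pq; hence a minimal normal subgroup has just one simple
    factor, is nonabelian and has trivial centraliser.  Then G acts faithfully
    by conjugation on a nonabelian simple group, so that G is almost simple
    (almost_simple_pq) and the hypothesis on almost simple images applies to G
    itself. *)

(** * Elements of the group ring and conjugation-invariant sets *)

Definition conj_closed (gT : finGroupType) (A : {set gT}) :=
  forall g h, g \in A -> (g ^ h) \in A.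

Lemma conj_closedJ (gT : finGroupType) (A : {set gT}) g h :
  conj_closed A -> ((g ^ h) \in A) = (g \in A).
Proof.
move=> cA; apply/idP/idP=> [gA|]; last exact: cA.
by rewrite -(conjgK h g); apply: cA.
Qed.

Lemma conj_closed1 (gT : finGroupType) : conj_closed [set 1 : gT].
Proof. by move=> g h; rewrite !inE => /eqP ->; rewrite conj1g. Qed.

Lemma expr_gcd_eq1 (R : nzRingType) (x : R) m n :
  (x ^+ m = 1 -> x ^+ n = 1 -> x ^+ gcdn m n = 1)%R.
Proof.
have [->|m_gt0] := posnP m; first by rewrite gcd0n.
move=> xm xn; have [a b e _] := egcdnP n m_gt0.
have: (x ^+ (a * m) = 1)%R by rewrite mulnC exprM xm expr1n.
by rewrite e exprD mulnC exprM xn expr1n mul1r.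
Qed.

Section GroupRingElements.
Local Open Scope ring_scope.
Variables (R : nzRingType) (gT : finGroupType).
Implicit Types (u v : grpring R gT) (A : {set gT}).

Definition single (a : R) (g : gT) : grpring R gT :=
  [ffun h => if h == g then a else 0].

(** When A is a conjugacy class, this is the partial augmentation of u at
    that class. *)
Definition paug A u : R := \sum_(g in A) u g.

Lemma single_mul a b g h : single a g * single b h = single (a * b) (g * h)%g.
Proof.
apply/ffunP=> k; rewrite ffunE (bigD1 g) //= big1 => [|l /negPf nlg].
  rewrite addr0 !ffunE eqxx -(inj_eq (mulgI g)) mulKVg.
  by case: eqP => _; rewrite ?mulr0.
by rewrite ffunE nlg mul0r.
Qed.

Lemma grpring_sum_single u : u = \sum_g single (u g) g.
Proof.
apply/ffunP=> h; rewrite sum_ffunE (bigD1 h) //= big1 => [|g /negPf ngh].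
  by rewrite addr0 ffunE eqxx.
by rewrite ffunE eq_sym ngh.
Qed.

Lemma single_prod n (a : 'I_n -> R) (w : 'I_n -> gT) :
  \prod_(i < n) single (a i) (w i) = single (\prod_(i < n) a i) (\prod_(i < n) w i)%g.
Proof.
elim: n a w => [|n IHn] a w; last by rewrite !big_ord_recl IHn single_mul.
by rewrite !big_ord0; apply/ffunP=> g; rewrite !ffunE; case: eqP.
Qed.

Lemma single1 : single 1 1%g = 1.
Proof. by apply/ffunP=> g; rewrite !ffunE; case: eqP. Qed.

Lemma grpring_exp u n :
  u ^+ n = \sum_(w : {ffun 'I_n -> gT})
             single (\prod_(i < n) u (w i)) (\prod_(i < n) w i)%g.
Proof.
under eq_bigr do rewrite -single_prod.
rewrite -(bigA_distr_bigA (fun _ g => single (u g) g)) /=.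
by under eq_bigr do rewrite -grpring_sum_single; rewrite prodr_const card_ord.
Qed.

Lemma paug_single A a h : paug A (single a h) = if h \in A then a else 0.
Proof.
rewrite /paug; under eq_bigr do rewrite ffunE.
rewrite -big_mkcondr /=; case: ifP => hA.
  rewrite (big_pred1 h) // => g /=; rewrite andbC.
  by have [->|] := eqVneq g h; rewrite ?hA.
by rewrite big_pred0 // => g; rewrite andbC; have [->|] := eqVneq g h.
Qed.

Lemma paug_exp A u n :
  paug A (u ^+ n) = \sum_(w : {ffun 'I_n -> gT} | (\prod_(i < n) w i)%g \in A)
                      \prod_(i < n) u (w i).
Proof.
rewrite grpring_exp /paug; under eq_bigr do rewrite sum_ffunE.
rewrite exchange_big [RHS]big_mkcond /=; apply: eq_bigr => w _.
exact: paug_single.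
Qed.

Lemma augmX u n : augm u = 1 -> augm (u ^+ n) = 1.
Proof.
by move=> au; elim: n => [|n IHn]; rewrite ?augm1 // exprS augmM au IHn mul1r.
Qed.

Lemma augm_paug u : augm u = paug setT u.
Proof. by apply: eq_bigl => g; rewrite in_setT. Qed.

Lemma paug1 u : paug [set 1%g] u = u 1%g.
Proof. exact: big_set1. Qed.

Lemma paugID A B u : paug A u = paug (A :&: B) u + paug (A :\: B) u.
Proof. exact: big_setID. Qed.

End GroupRingElements.

(** * Powers modulo prime powers: counting words up to rotation *)

Section Necklaces.
Local Open Scope ring_scope.
Variables (gT : finGroupType) (m : nat).
Local Notation word := {ffun 'I_m.+1 -> gT}.
Implicit Types (w : word).

Definition wprod w := (\prod_(i < m.+1) w i)%g.

(** Rotations of words: addition of indices is addition modulo the length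
    of the word. *)
Definition wshift w (j : 'I_m.+1) : word := [ffun i => w (i + j)].

Lemma wshift_is_action : is_action [set: 'I_m.+1] wshift.
Proof.
apply: is_total_action => [w|w i j]; apply/ffunP=> l; rewrite !ffunE.
  by rewrite addr0.
by rewrite -addrA [j + i]addrC.
Qed.

Canonical wshift_action := Action wshift_is_action.

(** The periodic extension of a word to all natural indices, which turns
    rotations into translations. *)
Definition wext w (i : nat) := w (inZp i).

Lemma wprodE w : wprod w = (\prod_(0 <= i < m.+1) wext w i)%g.
Proof. by rewrite big_mkord; apply: eq_bigr => i _; rewrite /wext valZpK. Qed.

Lemma wextD w i : wext w (i + m.+1) = wext w i.
Proof. by congr (w _); apply: val_inj; rewrite /= modnDr. Qed.

Lemma wext_shift w j i : wext (wshift w j) i = wext w (i + j).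
Proof. by rewrite /wext ffunE; congr (w _); apply: val_inj; rewrite /= modnDml. Qed.

(** A rotation moves a prefix of the word to its end, which conjugates the
    product by the product of that prefix. *)
Lemma wprod_shift w j :
  wprod (wshift w j) = (wprod w ^ (\prod_(0 <= i < j) wext w i))%g.
Proof.
have big_shift (f : nat -> gT) (a b : nat) :
    (\prod_(0 <= i < b) f (i + a)%N = \prod_(a <= i < a + b) f i)%g.
  by rewrite -{2}[a]add0n big_addn addKn.
rewrite !wprodE; under eq_bigr do rewrite wext_shift.
rewrite big_shift; apply: (mulgI (\prod_(0 <= i < j) wext w i)%g).
rewrite -conjgC -!big_cat_nat ?leq_addr //= addnC.
rewrite (big_cat_nat (leq0n m.+1)) ?leq_addr //=; congr (_ * _)%g.
by rewrite -big_shift; apply: eq_bigr => i _; rewrite wextD.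
Qed.

Lemma wprod_periodic w j t : m.+1 = (j * t)%N ->
  (forall i, wext w (i + j) = wext w i) ->
  wprod w = ((\prod_(0 <= i < j) wext w i) ^+ t)%g.
Proof.
move=> def_m per; rewrite wprodE def_m {def_m}.
elim: t => [|t IHt]; first by rewrite muln0 big_geq.
rewrite mulnS addnC (big_cat_nat (leq0n (j * t))) ?leq_addr //= IHt expgSr.
congr (_ * _)%g; rewrite -{1}[(j * t)%N]add0n big_addn addKn.
apply: eq_bigr => i _; elim: t {IHt} => [|t IHt]; first by rewrite muln0 addn0.
by rewrite mulnS addnCA addnC per.
Qed.

Local Notation to := wshift_action.

Lemma ordXE (i : 'I_m.+1) n : (i ^+ n)%g = i *+ n.
Proof. by elim: n => [|n IHn]; rewrite ?mulr0n ?expg0 // expgS mulrS IHn. Qed.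

(** The rotations form a cyclic group, so that the rotation whose amount is the
    index of the stabiliser of w, i.e., the length of the orbit, fixes w. *)
Lemma wshift_orbit_fix w i : wext w (i + #|orbit to setT w|) = wext w i.
Proof.
set j := #|_|; pose H := ('C_([set: 'I_m.+1])[w | to])%G.
pose c : 'I_m.+1 := inZp 1.
have nHT : ([set: 'I_m.+1] \subset 'N(H))%g.
  apply: sub_abelian_norm (subsetT _); apply/centsP=> x _ y _.
  exact: addrC.
have nH x : x \in 'N(H)%g by rewrite (subsetP nHT).
have : (c ^+ j)%g \in H.
  rewrite coset_idr // morphX //.
  have -> : j = #|[set: 'I_m.+1] / H|%g by rewrite card_quotient // -card_orbit.
  by rewrite expg_cardG // mem_quotient.
case/setIP=> _ /astab1P /= def_w; rewrite -[in RHS]def_w wext_shift ordXE.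
congr (w _); apply: val_inj; rewrite /= Zp_mulrn /= modnDmr.
by rewrite -[RHS]modnDmr modnMml mul1n modnDmr.
Qed.

(** The weight of a word and the membership of its product in A are
    invariant under rotation, so that each orbit contributes a multiple of its
    length; only orbits of length not divisible by M remain. *)
Lemma paug_exp_mod (M : nat) (A : {set gT}) (u : grpring int gT) : conj_closed A ->
  (M%:Z %| paug A (u ^+ m.+1)
           - \sum_(w : word | (wprod w \in A) && ~~ (M %| #|orbit to setT w|)%N)
               \prod_(i < m.+1) u (w i))%Z.
Proof.
move=> cA; rewrite paug_exp.
rewrite (bigID (fun w : word => ~~ (M %| #|orbit to setT w|)%N)) /= addrAC subrr add0r.
pose D := [set w : word | (wprod w \in A) && (M %| #|orbit to setT w|)%N].
rewrite (eq_bigl (mem D)) => [|w]; last by rewrite !inE negbK.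
have actD : [acts setT, on D | to].
  apply/actsP=> j _ w; rewrite !inE /= wprod_shift conj_closedJ //.
  by rewrite (orbit_act to w (in_setT j)).
rewrite (set_partition_big _ (orbit_partition actD)) /=.
apply: rpred_sum => _ /imsetP[w /[!inE] /andP[_ dvdM] ->].
rewrite (eq_bigr (fun=> \prod_(i < m.+1) u (w i))) => [|_ /orbitP[j _ <-]].
  by rewrite sumr_const -mulr_natr natz; apply: dvdz_mull; apply: dvdM.
rewrite [RHS](reindex_inj (addIr j)) /=.
by apply: eq_bigr => i _; rewrite ffunE.
Qed.

Lemma dvdn_orbit_word w : (#|orbit to setT w| %| m.+1)%N.
Proof. by rewrite (dvdn_trans (dvdn_orbit _ _ _)) // cardsT card_ord. Qed.

End Necklaces.

Section PrimePowers.
Local Open Scope ring_scope.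
Variables (gT : finGroupType) (r : nat).
Hypothesis pr_r : prime r.
Implicit Types (A : {set gT}) (u : grpring int gT).

(** A word of length r ^ (k + l) whose orbit has length at most r ^ k is a
    power of a shorter word with an exponent divisible by r ^ l, so that its
    product is not in A. *)
Lemma paug_exp_avoid A u k l : conj_closed A ->
    (forall h : gT, (h ^+ (r ^ l))%g \notin A) ->
  ((r ^ k.+1)%N%:Z %| paug A (u ^+ (r ^ (k + l))))%Z.
Proof.
move=> cA avoidA; have [m def_m] : exists m, (r ^ (k + l))%N = m.+1.
  by exists (r ^ (k + l)).-1; rewrite prednK // expn_gt0 prime_gt0.
rewrite def_m; have := paug_exp_mod m (r ^ k.+1) u cA.
rewrite big_pred0 ?subr0 // => w; apply/negbTE/negP=> /andP[wA].
have : (#|orbit (wshift_action gT m) setT w| %| r ^ (k + l))%N.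
  by rewrite def_m dvdn_orbit_word.
case/dvdn_pfactor=> // j _ def_j.
rewrite def_j dvdn_Pexp2l ?prime_gt1 // -leqNgt => le_jk.
move/negP: (avoidA ((\prod_(0 <= i < r ^ j) wext w i) ^+ (r ^ (k - j)))%g); apply.
rewrite -expgM -expnD -(@wprod_periodic _ _ _ (r ^ j)) // => [|i].
  by rewrite -expnD -def_m; congr (r ^ _)%N; rewrite addnA subnKC.
by rewrite -def_j wshift_orbit_fix.
Qed.

(** In the prime field the Frobenius automorphism fixes the images of
    integers. *)
Lemma int_fermat (a : int) : (r%:Z %| a ^+ r - a)%Z.
Proof.
have chr : r \in [pchar 'F_r] by rewrite pchar_Fp.
have := congr1 (fun x : 'F_r => x - a%:~R) (rmorph_int (GRing.pFrobenius_aut chr) a).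
rewrite /= GRing.pFrobenius_autE subrr => /eqP.
rewrite -rmorphXn -rmorphB /= dvdzE /=.
case: (a ^+ r - a) => n /=; rewrite ?NegzE ?rmorphN ?oppr_eq0 /=.
  by rewrite -(dvdn_pcharf chr).
by rewrite -[_%:~R]/(n.+1%:R) -(dvdn_pcharf chr).
Qed.

Lemma int_fermat_exp (a : int) k : (r%:Z %| a ^+ (r ^ k) - a)%Z.
Proof.
elim: k => [|k IHk]; first by rewrite subrr dvdz0.
rewrite expnSr exprM -(subrKA (a ^+ (r ^ k))).
by rewrite rpredD ?int_fermat.
Qed.

(** Only orbits of length 1 count modulo r; these are the constant words
    g ... g, of product g ^+ (r ^ k) and of weight u g ^+ (r ^ k), which is
    u g modulo r. *)
Lemma paug_exp_prime A u k : conj_closed A ->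
  (r%:Z %| paug A (u ^+ (r ^ k)) - paug [set g | (g ^+ (r ^ k))%g \in A] u)%Z.
Proof.
move=> cA; have [m def_m] : exists m, (r ^ k)%N = m.+1.
  by exists (r ^ k).-1; rewrite prednK // expn_gt0 prime_gt0.
rewrite -(subrKA (\sum_(g | (g ^+ (r ^ k))%g \in A) u g ^+ (r ^ k))) rpredD //; last first.
  rewrite [paug _ _](eq_bigl (fun g => (g ^+ (r ^ k))%g \in A)) => [|g]; last by rewrite inE.
  by rewrite -sumrB rpred_sum // => g _; apply: int_fermat_exp.
rewrite def_m; have := paug_exp_mod m r u cA.
set s := \sum_(w | _) _; suff -> : s = \sum_(g | (g ^+ m.+1)%g \in A) u g ^+ m.+1 by [].
have prod_const (g : gT) : wprod [ffun _ : 'I_m.+1 => g] = (g ^+ m.+1)%g.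
  by rewrite /wprod; under eq_bigr do rewrite ffunE; rewrite prodg_const card_ord.
rewrite /s (reindex_onto (fun g => [ffun _ : 'I_m.+1 => g]) (fun w => w ord0)) /=.
  apply: eq_big => [g|g _].
    rewrite ffunE eqxx andbT prod_const andbC -[RHS]andTb; congr (_ && _).
    have /orbit1P -> : [ffun _ : 'I_m.+1 => g] \in 'Fix_(wshift_action gT m)(setT)%g.
      by apply/afixP=> j _; apply/ffunP=> i; rewrite !ffunE.
    by rewrite cards1 dvdn1 neq_ltn prime_gt1 ?orbT.
  by under eq_bigr do rewrite ffunE; rewrite prodr_const card_ord.
move=> w /andP[_].
have : (#|orbit (wshift_action gT m) setT w| %| r ^ k)%N.
  by rewrite def_m dvdn_orbit_word.
case/dvdn_pfactor=> // -[_ orbit1|j _ ->]; last by rewrite expnS dvdn_mulr.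
move=> _; apply/ffunP=> i; rewrite ffunE.
have const j : wext w j = w ord0.
  elim: j => [|j IHj]; first by congr (w _); apply: val_inj; rewrite /= mod0n.
  by rewrite -addn1 -[1%N](expn0 r) -orbit1 wshift_orbit_fix.
by rewrite -(const i) /wext valZpK.
Qed.

End PrimePowers.

(** * Vanishing of sums of coefficients of torsion units *)

Section Vanishing.
Local Open Scope ring_scope.
Variable gT : finGroupType.
Implicit Types (A B : {set gT}) (u : grpring int gT).

(** By Euler's theorem u is its own power for infinitely many exponents
    r ^ e.  Elements of order divisible by r are not (r ^ l)-th powers for l
    large, so that paug_exp_avoid makes the integer paug A u divisible by
    arbitrarily large powers of r. *)
Lemma paug_prime_eq0 A u n r : (0 < n)%N -> u ^+ n = 1 ->
  prime r -> ~~ (r %| n)%N -> conj_closed A ->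
  (forall g, g \in A -> r %| #[g]%g)%N -> paug A u = 0.
Proof.
move=> n_gt0 un1 pr_r r'n cA rA.
pose l := logn r #|gT|; pose K := `|paug A u|%N.
have tot_gt0 : (0 < totient n)%N by rewrite totient_gt0.
(* K exceeds the number of factors r that paug A u may have, and e is a
   multiple of totient n at least equal to K + l. *)
pose e := (totient n * (K + l))%N.
have le_e : (K + l <= e)%N by rewrite /e leq_pmull.
have : ((r ^ (e - l).+1)%N%:Z %| paug A (u ^+ (r ^ (e - l + l))))%Z.
  apply: (paug_exp_avoid pr_r) => // h; apply/negP=> /rA.
  have h_gt0 := order_gt0 h.
  rewrite orderXgcd -[X in (X %| _)%N]expn1 pfactor_dvdn //; last first.
    by rewrite divn_gt0 ?gcdn_gt0 ?h_gt0 // dvdn_leq ?dvdn_gcdl.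
  have rl_gt0 : (0 < r ^ l)%N by rewrite expn_gt0 prime_gt0.
  have le_hl : (logn r #[h]%g <= logn r (r ^ l))%N.
    by rewrite pfactorK // dvdn_leq_log -?cardsT ?cardG_gt0 ?order_dvdG ?in_setT.
  by rewrite logn_div ?dvdn_gcdl // logn_gcd // (minn_idPl le_hl) subnn.
rewrite subnK ?(leq_trans _ le_e) ?leq_addl //.
have -> : u ^+ (r ^ e) = u.
  rewrite -(expr_mod _ un1) /e expnM -modnXm Euler_exp_totient.
    by rewrite modnXm exp1n (expr_mod _ un1) expr1.
  by rewrite prime_coprime.
move=> dvd; apply/eqP; rewrite -absz_eq0 -[_ == _]negbK -lt0n; apply/negP=> a0.
have := dvdn_leq a0 dvd; rewrite leqNgt => /negP; apply.
apply: leq_trans (ltn_expl _ (prime_gt1 pr_r)) _; rewrite leq_exp2l ?prime_gt1 //.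
by rewrite leqW // leq_subRL ?(leq_trans (leq_addl _ _) le_e) // addnC.
Qed.

(** Induction on #|A|: split off the elements of A whose order is divisible by
    one prime that does not divide n, to which paug_prime_eq0 applies. *)
Lemma paug_eq0 A u n : (0 < n)%N -> u ^+ n = 1 -> conj_closed A ->
  (forall g, g \in A -> ~~ \pi(n).-nat #[g]%g) -> paug A u = 0.
Proof.
move=> n_gt0 un1; have [k] := ubnP #|A|; elim: k A => // k IHk A ltAk cA A'n.
have [->|[g gA]] := set_0Vmem A; first by rewrite /paug big_set0.
have := A'n g gA; rewrite /pnat order_gt0 => /allPn[r].
rewrite mem_primes => /and3P[pr_r _ rg].
rewrite !inE => r_n.
have r'n : ~~ (r %| n)%N by apply: contra r_n; rewrite mem_primes pr_r n_gt0.
have gB : g \in [set h : gT | (r %| #[h]%g)%N] by rewrite inE.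
rewrite (paugID A [set h | (r %| #[h]%g)%N]).
rewrite (paug_prime_eq0 n_gt0 un1 pr_r r'n) => [|h x|h].
- rewrite add0r IHk => [//||h x|h]; last by case/setDP=> /A'n.
    rewrite ltnS in ltAk; apply: leq_trans ltAk; rewrite proper_card // properE subsetDl.
    by apply/subsetPn; exists g; rewrite // inE gB.
  by rewrite !inE orderJ => /andP[-> /cA ->].
- by rewrite !inE orderJ => /andP[/cA -> ->].
by rewrite !inE => /andP[].
Qed.

(** The form in which paug_eq0 is used: elements whose order has a prime
    divisor not dividing n may be discarded from A. *)
Lemma paug_trim A u n : (0 < n)%N -> u ^+ n = 1 -> conj_closed A ->
  paug A u = paug [set g in A | \pi(n).-nat #[g]%g] u.
Proof.
move=> n_gt0 un1 cA; rewrite (paugID A [set g | \pi(n).-nat #[g]%g]).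
rewrite [X in _ + X](paug_eq0 n_gt0 un1) ?addr0 => [|g h|g].
- by congr (paug _ u); apply/setP=> g; rewrite !inE.
- by rewrite !inE orderJ => /andP[-> /cA ->].
by rewrite !inE => /andP[].
Qed.

End Vanishing.

Section BermanHigman.
Local Open Scope ring_scope.
Variable gT : finGroupType.
Implicit Types u v : grpring int gT.

(** The matrix of the right multiplication by u in the basis of group
    elements. *)
Definition regmx u : 'M[algC]_#|gT| :=
  \matrix_(i, j) (u ((enum_val i)^-1 * enum_val j)%g)%:~R.

Lemma regmx1 : regmx 1 = 1%:M.
Proof.
apply/matrixP=> i j; rewrite !mxE ffunE -eq_mulVg1 (inj_eq enum_val_inj).
by case: (i == j).
Qed.

Lemma regmxM u v : regmx (u * v) = regmx u *m regmx v.
Proof.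
apply/matrixP=> i j; rewrite !mxE ffunE rmorph_sum /=.
rewrite (reindex_inj (mulgI (enum_val i)^-1%g)) /= big_enum_val.
apply: eq_bigr => k _; rewrite rmorphM /= !mxE; congr (_ * (v _)%:~R).
by rewrite invMg invgK -mulgA mulKVg.
Qed.

Lemma trace_regmx u : \tr (regmx u) = (#|gT| : int)%:~R * (u 1%g)%:~R.
Proof.
rewrite /mxtrace (eq_bigr (fun=> (u 1%g)%:~R)) => [|i _]; last by rewrite mxE mulVg.
by rewrite sumr_const card_ord mulr_natl.
Qed.

(** The regular representation restricted to the cyclic group generated by
    u has character value #|gT| * u 1 at u.  A character value has absolute
    value at most the degree #|gT|, and u 1 is a nonzero integer, so that
    equality holds; then u acts as a scalar, which the augmentation forces to
    be 1. *)
Lemma berman_higman u n : (0 < n)%N -> u ^+ n = 1 -> augm u = 1 ->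
  u 1%g != 0 -> u = 1.
Proof.
case: n => // m _ um1 au u1.
pose r (i : 'I_m.+1) := regmx (u ^+ i).
have r_repr : mx_repr [set: 'I_m.+1] r.
  split=> [|i j _ _]; first by rewrite /r expr0 regmx1.
  by rewrite /r -regmxM -exprD /= (expr_mod _ um1).
pose rG := MxRepresentation r_repr; pose c : 'I_m.+1 := inZp 1.
have rGc : rG c = regmx u by rewrite /= /r /= (expr_mod _ um1) expr1.
have chi1 : cfRepr rG 1%g = #|gT|%:R by rewrite cfRepr1.
have chic : cfRepr rG c = #|gT|%:R * (u 1%g)%:~R.
  by rewrite cfunE in_setT mulr1n rGc trace_regmx.
have G0 : 0 < #|gT|%:R :> algC by rewrite ltr0n -cardsT cardG_gt0.
have [] := @max_cfRepr_norm_scalar _ _ _ rG c (in_setT c).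
  apply/eqP; rewrite eq_le char1_ge_norm ?cfRepr_char //= chi1 chic.
  rewrite normrM normr_nat; apply: ler_peMr; first exact: ltW.
  rewrite -intr_norm ler1z.
  by rewrite -gtz0_ge1 normr_gt0.
move=> a _; rewrite rGc => /matrixP def_u.
have u_single g : g != 1%g -> u g = 0.
  move=> g1; have := def_u (enum_rank 1%g) (enum_rank g).
  rewrite !mxE !enum_rankK invg1 mul1g (inj_eq enum_rank_inj) eq_sym (negPf g1) mulr0n.
  by move/eqP; rewrite intr_eq0 => /eqP.
have def_u1 : u 1%g = 1.
  by rewrite -au /augm (bigD1 1%g) //= big1 ?addr0.
apply/ffunP=> g; rewrite ffunE; have [->|g1] := eqVneq g 1%g; first by rewrite def_u1.
by rewrite u_single.
Qed.

End BermanHigman.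

(** * Reduction modulo a normal subgroup *)

Section PushForward.
Local Open Scope ring_scope.
Variables (gT rT : finGroupType) (f : gT -> rT).
Hypothesis fM : {morph f : x y / (x * y)%g}.
Implicit Types u v : grpring int gT.

(** The ring morphism between group rings induced by f. *)
Definition grmap u : grpring int rT := [ffun y => \sum_(x | f x == y) u x].

Lemma paug_grmap B u : paug B (grmap u) = paug (f @^-1: B) u.
Proof.
rewrite /paug [RHS](partition_big f (mem B)) => [|x]; last by rewrite inE.
apply: eq_bigr => y By; rewrite ffunE; apply: eq_bigl => x.
by rewrite inE; case: eqP => [->|]; rewrite ?andbF ?By.
Qed.

Lemma augm_grmap u : augm (grmap u) = augm u.
Proof.
by rewrite !augm_paug paug_grmap; congr (paug _ u); apply/setP=> x; rewrite !inE.
Qed.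

Lemma conj_closed_preim B : conj_closed B -> conj_closed (f @^-1: B).
Proof.
have fJ g h : f (g ^ h)%g = (f g ^ f h)%g.
  by apply: (mulgI (f h)); rewrite -fM -!conjgC fM.
by move=> cB g h; rewrite !inE fJ => /cB.
Qed.

Lemma grmapM u v : grmap (u * v) = grmap u * grmap v.
Proof.
apply/ffunP=> y; rewrite !ffunE; under eq_bigr do rewrite ffunE.
rewrite exchange_big (partition_big f xpredT) //=; apply: eq_bigr => z _.
rewrite ffunE mulr_suml; apply: eq_bigr => h /eqP <-.
rewrite -mulr_sumr; congr (_ * _); rewrite ffunE (reindex_inj (mulgI h)) /=.
apply: eq_big => [x|x _]; last by rewrite mulKg.
by rewrite fM -(inj_eq (mulgI (f h)^-1%g)) mulKg.
Qed.

Lemma grmap1 : grmap 1 = 1.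
Proof.
have f1 : f 1%g = 1%g by apply: (mulgI (f 1%g)); rewrite -fM !mulg1.
apply/ffunP=> y; rewrite !ffunE big_mkcond (bigD1 1%g) //= big1 => [|x /negPf x1].
  by rewrite addr0 f1 ffunE eqxx eq_sym; case: eqP.
by rewrite ffunE x1; case: ifP.
Qed.

Lemma grmapX u n : grmap (u ^+ n) = grmap u ^+ n.
Proof. by elim: n => [|n IHn]; rewrite ?expr0 ?grmap1 // !exprS grmapM IHn. Qed.

End PushForward.

Section NormalSubgroup.
Local Open Scope ring_scope.
Variables (gT : finGroupType) (N : {group gT}).
Hypothesis nN : N <| [set: gT].
Implicit Types u v : grpring int gT.

Lemma cosetM : {morph coset N : x y / (x * y)%g}.
Proof. by move=> x y; rewrite morphM // (subsetP (normal_norm nN)). Qed.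

Lemma conj_closed_normal : conj_closed N.
Proof. by move=> g h gN; rewrite memJ_norm // (subsetP (normal_norm nN)) ?in_setT. Qed.

(** This coefficient decides, by berman_higman, whether the image of a
    torsion unit is trivial. *)
Lemma grmap_coset1 u : grmap (coset N) u 1%g = paug N u.
Proof.
rewrite -paug1 paug_grmap; congr (paug _ u).
apply/setP=> x; rewrite !inE; apply/eqP/idP=> [/coset_idr->//|/coset_id//].
exact: (subsetP (normal_norm nN)).
Qed.

(** If q does not divide #|N|, the only element of N whose order is a power
    of q is 1, so that the sum of v over N reduces to the coefficient at 1,
    which vanishes unless v is 1. *)
Lemma prime_dvd_kernel v q : prime q -> v ^+ q = 1 -> augm v = 1 -> v <> 1 ->
  paug N v = 1 -> (q %| #|N|)%N.
Proof.
move=> pr_q vq av v1 Nv; apply/negPn/negP => q'N; case: v1.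
apply: (@berman_higman _ _ q) => //; first exact: prime_gt0.
rewrite -paug1; have <- : paug N v = paug [set 1%g] v; last by rewrite Nv.
rewrite (paug_trim (prime_gt0 pr_q) vq conj_closed_normal); congr (paug _ v).
apply/setP=> g; rewrite !inE (eq_pnat _ (pi_of_prime pr_q)).
apply/andP/eqP=> [[gN q_g]|->]; last by rewrite group1 order1.
apply/eqP; rewrite -order_eq1; apply/eqP/(pnat_1 q_g).
by apply: pnat_dvd (order_dvdG gN) _; rewrite p'natE.
Qed.

(** If N is a p'-group and no element has order pq, then the sum of u over
    the p-elements of the group is 1, computed modulo N, but is also 0
    modulo p, computed from the coefficient at 1 of a power of u. *)
Lemma prime_dvd_normal u p q : prime p -> prime q -> p != q ->
  u ^+ (p * q) = 1 -> augm u = 1 -> u ^+ p <> 1 -> u ^+ q <> 1 ->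
  (forall g : gT, ~~ (p * q %| #[g]%g)%N) ->
  grmap (coset N) u ^+ p = 1 -> (p %| #|N|)%N.
Proof.
move=> pr_p pr_q npq un au up uq no_pq; set ub := grmap _ u => ubp.
apply/negPn/negP=> p'N.
have p_gt0 := prime_gt0 pr_p; have q_gt0 := prime_gt0 pr_q.
have n_gt0 : (0 < p * q)%N by rewrite muln_gt0 p_gt0.
have pi_p : \pi(p) =i (p : nat_pred) by move=> r; rewrite pi_of_prime.
have aub : augm ub = 1 by rewrite augm_grmap.
have ub1 : ub 1%g = 0.
  apply/eqP/negPn/negP=> /(berman_higman p_gt0 ubp aub) eub.
  case/negP: p'N; apply: (@prime_dvd_kernel (u ^+ q)); rewrite ?augmX //.
    by rewrite -exprM mulnC.
  rewrite -grmap_coset1 (grmapX cosetM) -/ub eub expr1n ffunE eqxx //.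
have u1 : u 1%g = 0.
  by apply/eqP/negPn/negP=> /(berman_higman n_gt0 un au) eu; case: up; rewrite eu expr1n.
pose P := [set g : gT | p.-nat #[g]%g].
have Pu : paug P u = 1.
  pose T := [set y : coset_of N | p.-nat #[y]%g].
  (* By paug_trim only p-elements of the quotient count in the augmentation. *)
  have <- : paug (T :\ 1%g) ub = 1.
    have := aub; rewrite augm_paug (paug_trim p_gt0 ubp) => [|y z]; last by rewrite !in_setT.
    rewrite (_ : [set y in _ | _] = T); last first.
      by apply/setP=> y; rewrite !inE /=; apply: eq_pnat.
    rewrite (paugID _ [set 1%g]) (_ : T :&: _ = [set 1%g]) ?paug1 ?ub1 ?add0r //.
    by apply/setIidPr; rewrite sub1set inE order1.
  rewrite /ub paug_grmap [RHS](paug_trim n_gt0 un); last first.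
    apply: (conj_closed_preim cosetM) => y z.
    by rewrite !inE orderJ conjg_eq1.
  rewrite (paugID P [set 1%g]) (_ : P :&: _ = [set 1%g]); last first.
    by apply/setIidPr; rewrite sub1set inE order1.
  rewrite paug1 u1 add0r; congr (paug _ u); apply/esym/setP=> g; rewrite !inE.
  have nNg : g \in 'N(N) by rewrite (subsetP (normal_norm nN)).
  have gN_g : (#[coset N g] %| #[g])%N by apply: morph_order.
  (* An element g whose order involves only p and q is a nontrivial p-element
     if and only if its coset is: if the coset is, p divides #[g] and so q
     does not; conversely g is not in the p'-group N. *)
  apply/andP/andP=> [[/andP[gN1 p_gN] pq_g]|[g1 p_g]].
    have pg : (p %| #[g])%N.
      apply: dvdn_trans gN_g; apply: contraR gN1; rewrite -p'natE // => p'gN.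
      by rewrite -order_eq1; apply/eqP/(pnat_1 p_gN).
    have q'g : ~~ (q %| #[g])%N.
      apply: contra (no_pq g) => qg; rewrite Gauss_dvd ?pg //.
      by rewrite prime_coprime // dvdn_prime2.
    split; first by apply: contraNneq gN1 => ->; rewrite coset_id.
    apply/pnatP=> // r pr_r rg; have := pnatPpi pq_g.
    move/(_ r); rewrite mem_primes pr_r rg order_gt0 => /(_ isT).
    rewrite mem_primes pr_r n_gt0 Euclid_dvdM // !dvdn_prime2 //.
    by case/orP=> [//|/eqP eq_rq]; rewrite -eq_rq rg in q'g.
  split; last first.
    apply: sub_in_pnat p_g => r _ /eqP ->.
    by rewrite mem_primes pr_p n_gt0 dvdn_mulr.
  rewrite (pnat_dvd gN_g p_g) andbT; apply: contraNneq g1 => gN1.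
  rewrite -order_eq1; apply/eqP/(pnat_1 p_g).
  by apply: pnat_dvd (order_dvdG (coset_idr nNg gN1)) _; rewrite p'natE.
(* The exponent is large enough for the (p ^ k)-th roots of 1 to be all the
   p-elements, and positive so that u ^+ (p ^ k) has order q. *)
pose k := (logn p #|gT|).+1.
have up1 : u ^+ (p ^ k) <> 1.
  move=> upk; case: up; have := expr_gcd_eq1 upk un.
  rewrite expnS -muln_gcdr (eqP (coprimeXl _ _)) ?muln1 //.
  by rewrite prime_coprime // dvdn_prime2.
have := paug_exp_prime pr_p u k (@conj_closed1 _).
rewrite (_ : [set g | _] = P); last first.
  apply/setP=> g; rewrite !inE -order_dvdn; apply/idP/idP=> [gpk|p_g].
    by apply: pnat_dvd gpk _; rewrite pnatX pnat_id.
  rewrite -(part_pnat_id p_g) p_part dvdn_exp2l // /k ltnW // ltnS.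
  by rewrite dvdn_leq_log -?cardsT ?cardG_gt0 ?order_dvdG ?in_setT.
rewrite Pu paug1.
have -> : (u ^+ (p ^ k)) 1%g = 0.
  apply/eqP/negPn/negP=> /berman_higman; apply: contra_not up1; apply.
  - exact: n_gt0.
  - by rewrite exprAC un expr1n.
  exact: augmX.
by rewrite sub0r dvdzE /= dvdn1 => /eqP p1; rewrite p1 in pr_p.
Qed.

End NormalSubgroup.

(** * Groups in which every nontrivial normal subgroup has order divisible by pq *)

Section GroupTheory.
Variables (gT : finGroupType) (p q : nat).
Hypotheses (pr_p : prime p) (pr_q : prime q) (npq : p != q).
Implicit Types H K N : {group gT}.

Lemma order_pq_of_cent H K : p %| #|H| -> q %| #|K| -> K \subset 'C(H) ->
  exists g : gT, p * q %| #[g].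
Proof.
move=> pH qK cHK; have [x Hx ox] := Cauchy pr_p pH; have [y Ky oy] := Cauchy pr_q qK.
have cxy : commute x y by apply: commute_sym; apply: (centP (subsetP cHK y Ky)).
by exists (x * y); rewrite orderM // ox oy // prime_coprime // dvdn_prime2.
Qed.

Hypothesis no_pq : forall g : gT, ~~ (p * q %| #[g]).

Lemma not_cent H K : p %| #|H| -> q %| #|K| -> ~~ (K \subset 'C(H)).
Proof.
by move=> pH qK; apply/negP=> /(order_pq_of_cent pH qK)[g]; apply/negP.
Qed.

(** N is a direct product of #|I| isomorphic copies of a simple group H,
    whose order has the same prime divisors as that of N; two different copies
    would commute, against not_cent. *)
Lemma charsimple_simple N : charsimple N -> p %| #|N| -> q %| #|N| -> simple N.
Proof.
move=> /charsimple_dprod[H [sHN simH [I _ defN]]] pN qN.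
have cardN : #|N| = (#|H| ^ #|I|)%N.
  rewrite -(bigdprod_card defN) -prod_nat_const; apply: eq_bigr => f _.
  exact/card_imset/perm_inj.
have pH : p %| #|H| by move: pN; rewrite cardN Euclid_dvdX // => /andP[].
have qH : q %| #|H| by move: qN; rewrite cardN Euclid_dvdX // => /andP[].
have [I0|[f If]] := set_0Vmem I.
  by rewrite cardN I0 cards0 Euclid_dvd1 in pN.
move: defN; rewrite (bigD1 f) //= => defN.
have [[K L defK defL] _ cKL _] := dprodP defN.
have cardK : #|K| = #|H| by rewrite -defK; apply/card_imset/perm_inj.
move: (dprod_card defN); rewrite defK defL cardK cardN => cardL.
have cLp : ~~ (q %| #|L|).
  have pK : p %| #|K| by rewrite cardK.
  by apply/negP=> /(not_cent pK); rewrite -defK -defL cKL.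
have Hgt0 := cardG_gt0 H.
have I_gt0 : 0 < #|I| by rewrite card_gt0; apply/set0Pn; exists f.
move: cardL; rewrite -(prednK I_gt0) expnS => /eqP.
rewrite eqn_pmul2l // => /eqP cardL.
have I1 : #|I|.-1 = 0%N.
  by apply/eqP; rewrite eqn0Ngt; apply: contra cLp => j0; rewrite cardL Euclid_dvdX // qH.
suff <- : H :=: N by [].
by apply/eqP; rewrite eqEcard sHN cardN -(prednK I_gt0) I1 expn1 leqnn.
Qed.

End GroupTheory.

Section ConjugationRep.
Variables (gT : finGroupType) (N : {group gT}).
Hypothesis nN : [set: gT] \subset 'N(N).
Local Notation S := (subg_of N).

Let memJN (x : S) g : sgval x ^ g \in N.
Proof. by rewrite memJ_norm ?subgP // (subsetP nN) ?in_setT. Qed.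

Lemma conj_subg_inj g : injective (fun x : S => subg N (sgval x ^ g)).
Proof.
move=> x y /(congr1 (@sgval _ _)); rewrite !subgK ?memJN // => /conjg_inj.
exact: val_inj.
Qed.

Definition conj_subg g : {perm S} := perm (@conj_subg_inj g).

Lemma conj_subgE g (x : S) : sgval (conj_subg g x) = sgval x ^ g.
Proof. by rewrite permE subgK. Qed.

Lemma conj_subgM : {in [set: gT] &, {morph conj_subg : g h / g * h}}.
Proof.
move=> g h _ _; apply/permP=> x; apply: val_inj.
by rewrite /= permM !conj_subgE conjgM.
Qed.

Canonical conj_subg_morphism := Morphism conj_subgM.

(** Conjugation embeds the group into the automorphisms of N, since 'C(N) is
    trivial, and maps N onto the inner automorphisms. *)
Lemma almost_simple_conj : simple N -> ~~ abelian N -> 'C(N) = 1 -> almost_simple gT.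
Proof.
move=> simN abN CN; exists S, (conj_subg @* [set: gT])%G.
have isoN : N \isog [set: S] by apply: isog_subg.
split.
- by rewrite -(isog_simple isoN).
- by rewrite -(isog_abelian isoN).
- apply/subsetP=> _ /morphimP[s _ _ ->].
  apply/morphimP; exists (sgval s); rewrite ?in_setT //.
  by apply/permP=> x; apply: val_inj; rewrite conj_autE ?in_setT //= conj_subgE.
- apply/subsetP=> _ /morphimP[g _ _ ->]; rewrite inE; apply/andP; split.
    by apply/subsetP=> x _; rewrite in_setT.
  apply/morphicP=> x y _ _; apply: val_inj.
  by rewrite /= !conj_subgE /= conjMg.
apply: sub_isog => //; apply/subsetP=> g /morphpreP[_ /set1P g1].
rewrite inE -in_set1 -[[set 1]]/(1 : {set gT}) -CN; apply/centP=> x Nx.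
have /(congr1 (@sgval _ _)) := congr1 (fun s : {perm S} => s (subg N x)) g1.
rewrite conj_subgE perm1 subgK // => xg.
by apply/commute_sym/commgP/conjg_fixP.
Qed.

End ConjugationRep.

(** The centraliser of a minimal normal subgroup N is normal and commutes
    with N, so that not_cent leaves no room for it. *)
Lemma almost_simple_pq (gT : finGroupType) p q : prime p -> prime q -> p != q ->
  (forall g : gT, ~~ (p * q %| #[g])) -> [set: gT] :!=: 1 ->
  (forall N : {group gT}, N <| [set: gT] -> N :!=: 1 -> p %| #|N| /\ q %| #|N|) ->
  almost_simple gT.
Proof.
move=> pr_p pr_q npq no_pq ntG dvdN.
have nGG : [set: gT] \subset 'N([set: gT]) by apply: normG.
have [N minN _] := minnormal_exists ntG nGG.
have [/andP[ntN nNG] _] := mingroupP minN.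
have nsN (K : {group gT}) : [set: gT] \subset 'N(K) -> K <| [set: gT].
  by move=> nK; rewrite /normal subsetT.
have [pN qN] := dvdN N (nsN N nNG) ntN.
apply: (almost_simple_conj nNG).
- exact: charsimple_simple (minnormal_charsimple minN) pN qN.
- exact: not_cent pN qN.
have nC : [set: gT] \subset 'N('C(N)) by rewrite norms_cent.
apply/eqP/negPn/negP=> ntC; have [pC qC] := dvdN 'C(N)%G (nsN _ nC) ntC.
by case/negP: (not_cent pr_p pr_q npq no_pq pN qC).
Qed.

(** * Torsion units and the prime graph *)

Section NUnits.
Variable gT : finGroupType.
Implicit Types (u : grpring int gT).

Lemma nunitX (x : nunit gT) n : (x ^+ n).1 = (x.1 ^+ n)%R.
Proof. by elim: n => [|n IHn] //; rewrite expgS exprS -IHn. Qed.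

Lemma nunitX_eq1 (x : nunit gT) n : (x ^+ n = 1) <-> (x.1 ^+ n = 1)%R.
Proof.
rewrite -nunitX; split=> [-> //|xn1]; exact: (@nunit_inj _ _ (1 : nunit gT)).
Qed.

Lemma nunit_of_torsion u n : (0 < n)%N -> (u ^+ n = 1)%R -> augm u = 1%R ->
  exists x : nunit gT, x.1 = u.
Proof.
case: n => // n _ un au.
have nu : [&& (u, u ^+ n)%R.1 * (u, u ^+ n)%R.2 == 1, (u, u ^+ n)%R.2 * (u, u ^+ n)%R.1 == 1
        & augm (u, u ^+ n)%R.1 == 1]%R.
  by rewrite /= -exprS -exprSr un au !eqxx.
by exists (NUnit nu).
Qed.

(** The basis element at g is a normalised unit of the same order as g. *)
Lemma nunit_of_elt (g : gT) : exists x : nunit gT, has_order x #[g].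
Proof.
have singleX n : ((single 1 g : grpring int gT) ^+ n = single 1 (g ^+ n))%R.
  by elim: n => [|n IHn]; rewrite ?single1 // exprS IHn single_mul mulr1 expgS.
have single_eq1 n : ((single 1 g : grpring int gT) ^+ n = 1)%R <-> g ^+ n = 1.
  rewrite singleX -single1; split=> [/ffunP/(_ 1)|-> //]; rewrite !ffunE eqxx.
  by case: eqP.
have [||x def_x] := @nunit_of_torsion (single 1%R g) #[g] (order_gt0 g).
- by apply/single_eq1; rewrite expg_order.
- by rewrite /augm (bigD1 g) //= big1 => [|h /negPf hg]; rewrite ffunE ?eqxx ?hg ?addr0.
exists x; have [_ g1 gm] := (has_orderE g #[g]).2 erefl.
split=> [||m lt_m]; first exact: order_gt0.
  by apply/nunitX_eq1; rewrite def_x; apply/single_eq1.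
by move/nunitX_eq1; rewrite def_x => /single_eq1; apply: gm.
Qed.

Lemma nunit_order_pq u p q : prime p -> prime q -> (u ^+ (p * q) = 1)%R ->
  augm u = 1%R -> (u ^+ p <> 1)%R -> (u ^+ q <> 1)%R ->
  exists x : nunit gT, has_order x (p * q)%N.
Proof.
move=> pr_p pr_q un au up uq.
have n_gt0 : (0 < p * q)%N by rewrite muln_gt0 !prime_gt0.
have [x def_x] := nunit_of_torsion n_gt0 un au; exists x.
split=> // [|m /andP[m_gt0 lt_mn] /nunitX_eq1]; rewrite ?def_x.
  by apply/nunitX_eq1; rewrite def_x.
move=> um; have := expr_gcd_eq1 um un.
set d := gcdn m _ => ud.
have lt_d : (d < p * q)%N by apply: leq_ltn_trans lt_mn; rewrite dvdn_leq ?dvdn_gcdl.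
have d_n : d %| p * q by apply: dvdn_gcdr.
(* A proper divisor of pq divides p or is equal to q. *)
have [qd|q'd] := boolP (q %| d); last first.
  case: up; have dp : d %| p.
    by rewrite -(@Gauss_dvdl d p q) // coprime_sym prime_coprime.
  by rewrite -(divnK dp) mulnC exprM ud expr1n.
case/dvdnP: qd ud lt_d d_n => e -> ue lt_e.
rewrite dvdn_pmul2r ?prime_gt0 // => /(primeP pr_p).2 /orP[]/eqP e1; last first.
  by rewrite e1 ltnn in lt_e.
by rewrite e1 mul1n in ue.
Qed.

Lemma has_order_nunit (x : nunit gT) n : has_order x n ->
  [/\ (0 < n)%N, (x.1 ^+ n = 1)%R, augm x.1 = 1%R
    & forall m, (0 < m < n)%N -> (x.1 ^+ m <> 1)%R].
Proof.
case=> n_gt0 xn xm; have [_ _ ax _] := nunitP x.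
by split=> // [|m /xm]; [apply/nunitX_eq1 | move=> nx /nunitX_eq1].
Qed.

(** The case where the normal subgroup is the whole group, whose sum of
    coefficients is the augmentation. *)
Lemma prime_dvd_order_group p (v : grpring int gT) : prime p -> (v ^+ p = 1)%R ->
  augm v = 1%R -> v <> 1%R -> p %| #|[set: gT]|.
Proof.
move=> pr_p vp av v1.
apply: (prime_dvd_kernel (N := [set: gT]%G) (normal_refl _) pr_p vp av v1).
by rewrite -augm_paug.
Qed.

(** Cohn and Livingstone's theorem for prime orders. *)
Lemma prime_vertex_nunit p : prime_vertex (nunit gT) p <-> prime_vertex gT p.
Proof.
split=> -[pr_p [x ox]]; split=> //; last first.
  by move/has_orderE: ox => <-; apply: nunit_of_elt.
have [_ xp ax xm] := has_order_nunit ox.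
have x1 : x.1 <> 1%R by rewrite -[x.1]expr1; apply: xm; rewrite prime_gt1.
have [g _ og] := Cauchy pr_p (prime_dvd_order_group pr_p xp ax x1).
by exists g; apply/has_orderE.
Qed.

End NUnits.

Lemma prime_dvd_normal_both (gT : finGroupType) (N : {group gT}) (u : grpring int gT) p q :
  N <| [set: gT] -> prime p -> prime q -> p != q ->
  (u ^+ (p * q) = 1)%R -> augm u = 1%R -> (u ^+ p <> 1)%R -> (u ^+ q <> 1)%R ->
  (forall g : gT, ~~ (p * q %| #[g])) ->
  (grmap (coset N) u ^+ p = 1)%R -> p %| #|N| /\ q %| #|N|.
Proof.
move=> nN pr_p pr_q npq un au up uq no_pq ubp; split.
  exact: prime_dvd_normal pr_p pr_q npq un au up uq no_pq ubp.
apply: (prime_dvd_kernel nN pr_q (v := u ^+ p)%R) => //; rewrite ?augmX -?exprM //.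
by rewrite -grmap_coset1 // (grmapX (cosetM nN)) ubp ffunE eqxx.
Qed.

(** Induction on the order of the group: quotients by nontrivial normal
    subgroups satisfy the same hypothesis on almost simple images. *)
Lemma torsion_pq (gT : finGroupType) p q (u : grpring int gT) :
  (forall X : finGroupType, almost_simple X -> [set: X] \homg [set: gT] -> PQ X) ->
  prime p -> prime q -> p != q ->
  (u ^+ (p * q) = 1)%R -> augm u = 1%R -> (u ^+ p <> 1)%R -> (u ^+ q <> 1)%R ->
  exists g : gT, p * q %| #[g].
Proof.
have [k] := ubnP #|[set: gT]|; elim: k gT u => // k IHk gT u ltGk hX.
move=> pr_p pr_q npq un au up uq.
have [/existsP //|/existsPn no_pq] := boolP [exists g : gT, p * q %| #[g]].
have dvdN (N : {group gT}) : N <| [set: gT] -> N :!=: 1 -> p %| #|N| /\ q %| #|N|.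
  move=> nN ntN; pose ub := grmap (coset N) u.
  have nNG := normal_norm nN.
  have [ubp|/eqP ubp] := eqVneq (ub ^+ p)%R 1%R.
    exact: prime_dvd_normal_both ubp.
  have [ubq|/eqP ubq] := eqVneq (ub ^+ q)%R 1%R.
    apply/and_comm; apply: prime_dvd_normal_both ubq => //; rewrite 1?eq_sym // mulnC //.
  have defQ : [set: coset_of N] = [set: gT] / N.
    apply/setP=> y; rewrite inE; have [x nNx ->] := cosetP y.
    by rewrite mem_quotient // in_setT.
  have [|X asX homX||| y pq_y] := IHk _ ub _ _ pr_p pr_q npq _ _ ubp ubq.
  - rewrite defQ; apply: leq_trans (ltn_quotient ntN (subsetT _)) _.
    by rewrite -ltnS.
  - by apply: hX asX (homg_trans homX _); rewrite defQ quotient_homg.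
  - by rewrite -(grmapX (cosetM nN)) un (grmap1 (cosetM nN)).
  - by rewrite augm_grmap.
  have [x nNx def_y] := cosetP y.
  case/negP: (no_pq x); apply: dvdn_trans pq_y _.
  by rewrite def_y morph_order.
have ntG : [set: gT] :!=: 1.
  apply: contraTneq (prime_dvd_order_group pr_p (v := u ^+ q)%R _ _ uq) => [G1||].
  - by rewrite G1 cards1 Euclid_dvd1.
  - by rewrite -exprM mulnC.
  exact: augmX.
have [_ /(_ p q)[edge_pq _]] := hX gT (almost_simple_pq pr_p pr_q npq no_pq ntG dvdN) (homg_refl _).
have [x ox] := nunit_order_pq pr_p pr_q un au up uq.
have xpq : edge (prime_graph (nunit gT)) p q.
  have nunit_p (r : nat) : prime r -> r %| #|[set: gT]| -> prime_vertex (nunit gT) r.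
    move=> pr_r /(Cauchy pr_r)[g _ og]; apply/prime_vertex_nunit.
    by split=> //; exists g; apply/has_orderE.
  have [pG qG] := dvdN [set: gT]%G (normal_refl _) ntG.
  by split; [apply: nunit_p | apply: nunit_p | apply/eqP | exists x].
have [_ _ _ [g /has_orderE og]] := edge_pq xpq.
by exists g; rewrite og.
Qed.

Theorem theorem2p1 (gT : finGroupType)
  (hX : forall X : finGroupType,
     almost_simple X -> [set: X] \homg [set: gT] -> PQ X) :
  PQ gT.
Proof.
split=> [p|p q]; first exact: prime_vertex_nunit.
split=> -[/prime_vertex_nunit vp /prime_vertex_nunit vq npq [x ox]]; split=> //.
  have [_ un au um] := has_order_nunit ox.
  have [[pr_p _] [pr_q _]] := (vp, vq).
  have [|||g pq_g] := torsion_pq hX pr_p pr_q _ un au; first exact/eqP.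
  - by apply: um; rewrite prime_gt0 //= -{1}[p]muln1 ltn_pmul2l ?prime_gt0 ?prime_gt1.
  - by apply: um; rewrite prime_gt0 //= -{1}[q]mul1n ltn_pmul2r ?prime_gt0 ?prime_gt1.
  have [e og] := dvdnP pq_g; exists (g ^+ e); apply/has_orderE.
  have := order_gt0 g; rewrite og muln_gt0 => /andP[e_gt0 _].
  by rewrite orderXdiv og ?dvdn_mulr // mulKn.
by move/has_orderE: ox => <-; apply: nunit_of_elt.
Qed.
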